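(* Let $G=(V,E)$ be a finite weighted graph with edge weights $\mu$, and let $\Omega\subset V$ be nonempty, such that $\widetilde{\Omega}$ is connected and $\delta\Omega$ has at least two vertices. Let $\lambda_1(\Omega)$ be the first nontrivial eigenvalue of the Dirichlet-to-Neumann operator $\Lambda$ on $\Omega$. Then $$\lambda_1(\Omega)\geq \frac{1}{2}\,h(\widetilde{\Omega})\,h_J(\widetilde{\Omega}),$$ where $h(\widetilde{\Omega})$ is the classical Cheeger constant of $\widetilde{\Omega}$ and $h_J(\widetilde{\Omega})$ is the Jammes-type Cheeger constant of $\widetilde{\Omega}$.
   Context: $V$ is a finite set and $\mu:V\times V\to[0,\infty)$, $(x,y)\mapsto\mu_{xy}=\mu_{yx}$, is a symmetric weight function; $\{x,y\}\in E$ (written $x\sim y$) iff $\mu_{xy}>0$. Self-loops are allowed. For $\Omega_1,\Omega_2\subset V$, $E(\Omega_1,\Omega_2)=\{\{x,y\}\in E: x\in\Omega_1,y\in\Omega_2\}$. For $F\subset E$, $\mu(F)=\sum_{\{x,y\}\in F}\mu_{xy}$. The vertex boundary is $\delta\Omega=\{x\in V\setminus\Omega: x\sim y\text{ for some }y\in\Omega\}$, and $\overline{\Omega}=\Omega\cup\delta\Omega$. The graph $\widetilde{\Omega}$ has vertex set $\overline{\Omega}$ and edge set $E(\Omega,\overline{\Omega})$. The measure $m:\overline{\Omega}\to(0,\infty)$ is $m_x=\sum_{y\in V,\,y\sim x}\mu_{xy}$ for $x\in\Omega$ and $m_x=\sum_{y\in\Omega,\,y\sim x}\mu_{xy}$ for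 $x\in\delta\Omega$; $m(A)=\sum_{x\in A}m_x$. For $f:\overline{\Omega}\to\mathbb{R}$: $\Delta f(x)=\frac1{m_x}\sum_{y\sim x}\mu_{xy}(f(y)-f(x))$ for $x\in\Omega$, and $\frac{\partial f}{\partial n}(z)=\frac1{m_z}\sum_{x\in\Omega,\,x\sim z}\mu_{zx}(f(z)-f(x))$ for $z\in\delta\Omega$. For $\varphi:\delta\Omega\to\mathbb{R}$, $u_\varphi:\overline{\Omega}\to\mathbb{R}$ is the unique function with $\Delta u_\varphi=0$ on $\Omega$ and $u_\varphi=\varphi$ on $\delta\Omega$. The Dirichlet-to-Neumann operator is $\Lambda:\mathbb{R}^{\delta\Omega}\to\mathbb{R}^{\delta\Omega}$, $\Lambda\varphi=\frac{\partial u_\varphi}{\partial n}$; it is self-adjoint and nonnegative for $\langle\varphi,\psi\rangle_{\delta\Omega}=\sum_{x\in\delta\Omega}\varphi(x)\psi(x)m_x$, with eigenvalues $0=\lambda_0(\Omega)<\lambda_1(\Omega)\le\cdots$ listed with multiplicity. For $A\subset\overline{\Omega}$, $\partial_\Omega A=E(A,V\setminus A)\cap E(\Omega,\overline{\Omega})$. Define $$h(\widetilde{\Omega})=\inf\left\{\frac{\mu(\partial_\Omega A)}{m(A)}:\emptyset\ne A\subset\overline{\Omega},\ m(A)\le\tfrac12 m(\overline{\Omega})\right\},$$ $$h_J(\widetilde{\Omega})=\inf\left\{\frac{\mu(\partial_\Omega A)}{m(A\cap\delta\Omega)}:A\subset\overline{\Omega},\ A\cap\delta\Omega\neq\emptyset,\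 m(A)\le\tfrac12 m(\overline{\Omega})\right\}.$$ *)

(* Defs.v *)
From HB Require Import structures.
From mathcomp Require Import all_boot all_order all_algebra.
From mathcomp Require Import boolp classical_sets reals.

Set Implicit Arguments.
Unset Strict Implicit.
Unset Printing Implicit Defensive.

Import Order.TTheory GRing.Theory Num.Theory.
Local Open Scope ring_scope.

Section WeightedGraph.
Variables (R : realType) (V : finType) (mu : V -> V -> R).

Definition adj : rel V := fun x y => 0 < mu x y.

(* An edge {x, y} is a subset of V, so a self-loop at x is the singleton {x}. *)
Definition edges_between (A B : {set V}) : {set {set V}} :=
  [set [set x; y] | x in A, y in B & adj x y]%SET.

(* The comparison of ranks in the enumeration of V selects exactly one of the
   ordered pairs (x, y), (y, x) representing the edge {x, y}. *)
Definition edge_weight (F : {set {set V}}) : R :=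
  \sum_(x : V) \sum_(y : V |
    (enum_rank x <= enum_rank y)%N && ([set x; y]%SET \in F)) mu x y.

Section Domain.
Variable Omega : {set V}.

Definition vbdry : {set V} :=
  [set x | (x \notin Omega) && [exists y in Omega, adj x y]]%SET.

Definition vclos : {set V} := (Omega :|: vbdry)%SET.

Definition tilde_edges : {set {set V}} := edges_between Omega vclos.

Definition tilde_connected : Prop :=
  forall x y, x \in vclos -> y \in vclos ->
    connect (fun a b => [set a; b]%SET \in tilde_edges) x y.

(* Only meaningful on vclos. *)
Definition vmeas (x : V) : R :=
  if x \in Omega then \sum_(y : V | adj y x) mu x y
  else \sum_(y in Omega | adj y x) mu x y.

Definition meas (A : {set V}) : R := \sum_(x in A) vmeas x.

Definition bdryT : finType := {x : V | x \in vbdry}.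
Definition closT : finType := {x : V | x \in vclos}.

Definition bdry_incl (z : bdryT) : closT :=
  exist _ (val z) (fintype.subsetP (finset.subsetUr Omega vbdry) _ (valP z)).

(* Used at points of Omega, all of whose neighbours lie in vclos. *)
Definition laplacian (f : {ffun closT -> R}) (x : closT) : R :=
  (vmeas (val x))^-1 *
    \sum_(y : closT | adj (val y) (val x)) mu (val x) (val y) * (f y - f x).

Definition normal_derivative (f : {ffun closT -> R}) (z : bdryT) : R :=
  (vmeas (val z))^-1 *
    \sum_(x : closT | (val x \in Omega) && adj (val x) (val z))
       mu (val z) (val x) * (f (bdry_incl z) - f x).

Definition is_harmonic_extension (phi : {ffun bdryT -> R^o})
    (u : {ffun closT -> R}) : Prop :=
  (forall x : closT, val x \in Omega -> laplacian u x = 0) /\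
  (forall z : bdryT, u (bdry_incl z) = phi z).

Definition harmonic_extension (phi : {ffun bdryT -> R^o}) :
    {ffun closT -> R} :=
  xget [ffun=> 0] [set u | is_harmonic_extension phi u]%classic.

(* R^o is R seen as a vector space over itself; it makes {ffun bdryT -> R^o}
   a vectType. *)
Definition DtN (phi : {ffun bdryT -> R^o}) : {ffun bdryT -> R^o} :=
  [ffun z => normal_derivative (harmonic_extension phi) z].

(* linfun packages DtN as an element of 'End(_), equal to DtN as a function
   because DtN is linear. DtN is self-adjoint, so the multiplicity of an
   eigenvalue is the dimension of its eigenspace. *)
Definition is_spectrum (s : seq R) : Prop :=
  sorted <=%R s /\
  forall a : R, count_mem a s = \dim (passmx.leigenspace (linfun DtN) a).

Definition spectrum : seq R := xget [::] [set s | is_spectrum s]%classic.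

Definition lambda (k : nat) : R := nth 0 spectrum k.

Definition edge_bdry (A : {set V}) : {set {set V}} :=
  (edges_between A (~: A) :&: tilde_edges)%SET.

Definition cheeger : R :=
  inf [set r : R | exists A : {set V},
    [/\ A != finset.set0, A \subset vclos, meas A <= 2^-1 * meas vclos &
        r = edge_weight (edge_bdry A) / meas A]]%classic.

Definition jammes_cheeger : R :=
  inf [set r : R | exists A : {set V},
    [/\ A \subset vclos, (A :&: vbdry != finset.set0)%SET,
        meas A <= 2^-1 * meas vclos &
        r = edge_weight (edge_bdry A) / meas (A :&: vbdry)%SET]]%classic.

End Domain.
End WeightedGraph.

(* Main.v *)
Require Import Defs.
From HB Require Import structures.
From mathcomp Require Import all_boot all_order all_algebra.
From mathcomp Require Import ring lra.
From mathcomp Require classical_sets.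
From mathcomp Require Import boolp reals complex polyrcf.

Set Implicit Arguments.
Unset Strict Implicit.
Unset Printing Implicit Defensive.

Import Order.TTheory GRing.Theory Num.Theory.
Local Open Scope ring_scope.

(* If phi is an eigenfunction for lambda_1 > 0, it is orthogonal to the
   constants, hence changes sign; replacing phi by - phi if necessary, its
   harmonic extension u satisfies m {u > 0} <= m(vclos) / 2. Let f = max(u, 0),
   P the sum of m f^2 over vclos, Q its sum over the boundary, and D the
   Dirichlet energy of f. Green's formula gives lambda_1 Q >= D. By the discrete
   coarea formula and the definition of the two Cheeger constants, the total
   variation C of f^2 satisfies C >= h P and C >= h_J Q, while Cauchy-Schwarz
   gives C^2 <= 2 P D. Hence h h_J P Q <= 2 lambda_1 P Q. *)

(** * Eigenvalues of self-adjoint endomorphisms *)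

Section SelfAdjoint.
Variable R : rcfType.

(** With v a row of [A ^+ k.+1] and [A ^+ k.+2 = 0], moving one factor [A] across the form gives B v
    v = 0. Definiteness then kills v, so the vanishing exponent descends to 1. *)
Lemma selfadjoint_nilpotent n (A : 'M[R]_n.+1) (B : 'rV[R]_n.+1 ->
  'rV[R]_n.+1 -> R) :
  (forall x, B x 0 = 0) -> (forall x, x != 0 -> 0 < B x x) ->
  (forall x y, B (x *m A) y = B x (y *m A)) ->
  forall k, A ^+ k = 0 -> A = 0.
Proof.
move=> B0r B_def A_adj; elim=> [|k IHk Ak0].
  by move/eqP; rewrite expr0 oner_eq0.
case: k IHk Ak0 => [_|k IHk Ak0]; first by rewrite expr1.
apply: IHk; apply/row_matrixP=> i; rewrite row0 rowE.
apply/eqP/negPn/negP => /B_def.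
by rewrite {1}exprSr -mulmxE mulmxA A_adj -mulmxA mulmxE -exprSr Ak0 mulmx0 B0r ltxx.
Qed.

Section Matrix.
Variables (n : nat) (A : 'M[R]_n) (B : 'rV[R]_n -> 'rV[R]_n -> R).
Hypothesis B_linear : forall y, linear_for *%R (B^~ y).
Hypothesis B_sym : forall x y, B x y = B y x.
Hypothesis B_def : forall x, x != 0 -> 0 < B x x.
Hypothesis A_adj : forall x y, B (x *m A) y = B x (y *m A).

Local Notation cmx := (map_mx (real_complex R)).
Local Notation remx := (map_mx (@complex.Re R)).
Local Notation immx := (map_mx (@complex.Im R)).

(** Write an eigenvector as p + iq with p, q real. Comparing B (pA) q with B p (qA) leaves Im c * (B
    p p + B q q) = 0, and the second factor vanishes only if p = q = 0. *)
Lemma selfadjoint_eigenvalue_Im0 (c : R[i]) :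
  eigenvalue (cmx A) c -> complex.Im c = 0.
Proof.
case/eigenvalueP => v vA v_neq0.
have reim j : (remx v *m A) 0 j = complex.Re ((v *m cmx A) 0 j)
           /\ (immx v *m A) 0 j = complex.Im ((v *m cmx A) 0 j).
  rewrite !mxE; elim/big_rec3: _ => // i a b d _ [-> ->].
  by rewrite !mxE; case: (v 0 i) b => [p q] [r s] /=; split; ring.
have reA : remx v *m A = complex.Re c *: remx v + (- complex.Im c) *: immx v.
  apply/rowP=> j; rewrite (reim j).1 vA !mxE.
  by case: c {vA} (v 0 j) => [p q] [r s] /=; ring.
have imA : immx v *m A = complex.Re c *: immx v + complex.Im c *: remx v.
  apply/rowP=> j; rewrite (reim j).2 vA !mxE.
  by case: c {vA reA} (v 0 j) => [p q] [r s] /=; ring.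
have B0l y : B 0 y = 0.
  by have := B_linear y (-1) 0 0; rewrite scaler0 addr0 mulN1r addNr.
have BDl a b x x' y : B (a *: x + b *: x') y = a * B x y + b * B x' y.
  rewrite B_linear; congr (_ + _).
  by have := B_linear y b x' 0; rewrite addr0 B0l addr0.
have Bge0 x : 0 <= B x x.
  by have [->|/B_def/ltW//] := eqVneq x 0; rewrite B0l.
have := A_adj (remx v) (immx v).
rewrite reA imA BDl [RHS]B_sym BDl [B (immx v) (remx v)]B_sym => /eqP.
rewrite -subr_eq0 opprD addrACA subrr add0r mulNr -opprD oppr_eq0 -mulrDr.
rewrite mulf_eq0 => /orP[/eqP//|].
rewrite paddr_eq0 // => /andP[im0 re0].
case/eqP: v_neq0; apply/rowP=> j.
have [re_v im_v] : remx v = 0 /\ immx v = 0.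
  split; apply/eqP/negPn/negP => /B_def.
    by rewrite (eqP re0) ltxx.
  by rewrite (eqP im0) ltxx.
have /rowP/(_ j) := re_v; have /rowP/(_ j) := im_v; rewrite !mxE.
by case: (v 0 j) => [p q] /= -> ->.
Qed.

(* If every eigenvalue vanished, the characteristic polynomial would split over
   R[i] as 'X^n; A would be nilpotent, hence 0 by self-adjointness. *)
Lemma selfadjoint_mx_neq0_eigenvalue :
  A != 0 -> exists2 a, a != 0 & eigenvalue A a.
Proof.
move=> A_neq0; apply: contrapT => no_eig.
(* A complex root is an eigenvalue of the complexified matrix, hence real, hence an eigenvalue of
   [A] itself. *)
have root0 (c : R[i]) : root (char_poly (cmx A)) c -> c = 0.
  move=> rc; have im0 : complex.Im c = 0.
    by apply: selfadjoint_eigenvalue_Im0; rewrite eigenvalue_root_char.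
  have cE : c = real_complex R (complex.Re c) by case: c im0 {rc} => p q /= ->.
  move: rc; rewrite cE -map_char_poly fmorph_root -eigenvalue_root_char => rc.
  have [->//|re_neq0] := eqVneq (complex.Re c) 0.
  by case: no_eig; exists (complex.Re c).
have [r charE] := closed_field_poly_normal (char_poly (cmx A)).
have charX : char_poly A = 'X^(size r).
  apply: (map_poly_inj (real_complex R)); rewrite map_char_poly /= map_polyXn.
  rewrite charE (monicP (char_poly_monic _)) scale1r.
  rewrite (eq_big_seq (fun _ => 'X));
    first by rewrite big_const_seq count_predT iter_mulr_1.
  move=> z zr; rewrite (root0 z) ?subr0 //.
  by rewrite charE (monicP (char_poly_monic _)) scale1r root_prod_XsubC.
move: A_neq0 B_linear B_sym B_def A_adj charX; clear; move: A B.
case: n => [|k] A1 B1; first by rewrite (flatmx0 A1) eqxx.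
move=> A_neq0 B_linear B_sym B_def A_adj charX.
case/eqP: A_neq0;
  apply: (@selfadjoint_nilpotent _ A1 B1 _ B_def A_adj (size r)).
  by move=> y; rewrite B_sym; have := B_linear y (-1) 0 0;
    rewrite scaler0 addr0 mulN1r addNr.
have := Cayley_Hamilton A1.
by rewrite charX rmorphXn /= horner_mx_X.
Qed.
End Matrix.

Section Endomorphism.
Import VectorInternalTheory.
Variables (vT : vectType R) (f : 'End(vT)).

Lemma lfun_mx (v : vT) : v2r (f v) = v2r v *m f2mx f.
Proof. by rewrite unlock /= r2vK. Qed.

Lemma eigenvalue_lfun (a : R) :
  reflect (exists2 v, v != 0 & f v = a *: v) (eigenvalue (f2mx f) a).
Proof.
apply: (iffP eigenvalueP) => -[v].
  move=> vf v0; exists (r2v v).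
    by apply: contraNneq v0 => v0; rewrite -[v]r2vK v0 linear0.
  by apply: v2r_inj; rewrite lfun_mx linearZ /= r2vK.
move=> v0 fv; exists (v2r v); first by rewrite -lfun_mx fv linearZ.
by apply: contraNneq v0 => v0; rewrite -[v]v2rK v0 linear0.
Qed.

Lemma eigenvalues_finite : exists s : seq R, forall a v, v != 0 ->
  f v = a *: v -> a \in s.
Proof.
exists (rootsR (char_poly (f2mx f))) => a v v0 fv.
have : eigenvalue (f2mx f) a by apply/eigenvalue_lfun; exists v.
rewrite eigenvalue_root_char.
apply: (root_roots_on (roots_on_rootsR _)) => //.
exact/monic_neq0/char_poly_monic.
Qed.

Lemma mem_leigenspace (a : R) v : (v \in passmx.leigenspace f a) =
  (f v == a *: v).
Proof. by rewrite memv_ker add_lfunE opp_lfunE scale_lfunE id_lfunE subr_eq0. Qed.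

(** [spectrum] is a choice with default [[::]]; this witness makes the choice meaningful. Candidates
    are deduplicated first, since each one contributes its whole eigenspace dimension. *)
Lemma eigenvalue_seq : exists s : seq R, sorted <=%R s /\
  forall a, count_mem a s = \dim (passmx.leigenspace f a).
Proof.
have [s0 s0P] := eigenvalues_finite.
pose s := flatten [seq nseq (\dim (passmx.leigenspace f a)) a | a <- undup s0].
exists (sort <=%R s); split; first exact/sort_sorted/le_total.
move=> a; rewrite count_sort count_flatten -map_comp sumnE big_map.
under eq_bigr do rewrite /= count_nseq.
have [as0|as0] := boolP (a \in undup s0).
  rewrite (bigD1_seq a) ?undup_uniq //= eqxx mul1n big1 ?addn0 // =>
    b /negPf ba.
  by rewrite ba.
rewrite big_seq big1 => [|b bs0]; last first.
  by rewrite /=; case: (b =P a) => [ba|//]; rewrite -ba bs0 in as0.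
apply/esym/eqP; rewrite dimv_eq0; apply: contraNT as0 => v0.
rewrite mem_undup; apply: (s0P a (vpick (passmx.leigenspace f a))).
  by rewrite vpick0.
by apply/eqP; rewrite -mem_leigenspace memv_pick.
Qed.

(** The form is pulled back along coordinates to reach the matrix statement. This will show that the
    spectrum of [DtN] contains more than 0. *)
Lemma selfadjoint_neq0_eigenvalue (B : vT -> vT -> R) :
  (forall y, linear_for *%R (B^~ y)) -> (forall x y, B x y = B y x) ->
  (forall x, x != 0 -> 0 < B x x) -> (forall x y, B (f x) y = B x (f y)) ->
  f != 0 -> exists a v, [/\ a != 0, v != 0 & f v = a *: v].
Proof.
move=> B_linear B_sym B_def f_adj f_neq0.
have [||||| a a0 /eigenvalue_lfun[v v0 fv]] :=
  @selfadjoint_mx_neq0_eigenvalue _ (f2mx f)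
  (fun x y => B (r2v x) (r2v y)).
- by move=> y a x x'; rewrite linearP B_linear.
- by move=> x y; rewrite B_sym.
- by move=> x x0; apply: B_def; apply: contraNneq x0 => x0;
    rewrite -[x]r2vK x0 linear0.
- have fr x : r2v (x *m f2mx f) = f (r2v x).
    by apply: v2r_inj; rewrite lfun_mx !r2vK.
  by move=> x y; rewrite !fr.
- apply: contraNneq f_neq0 => f0; apply/eqP/lfunP=> v; apply: v2r_inj.
  by rewrite lfun_mx f0 mulmx0 lfunE /= linear0.
by exists a, v.
Qed.

End Endomorphism.
End SelfAdjoint.

(** * Cauchy-Schwarz, discrete coarea, and facts on pairs and infima *)

Lemma weighted_cauchy_schwarz (R : realFieldType) (I : finType) (w a b :
  I -> R) :
  (forall i, 0 <= w i) ->
  (\sum_i w i * (a i * b i)) ^+ 2 <=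
    (\sum_i w i * a i ^+ 2) * (\sum_i w i * b i ^+ 2).
Proof.
move=> w_ge0; set S := \sum_i _; set P := \sum_i _; set Q := \sum_i _.
(* Lagrange's identity: this difference is the double sum of w i * w j * (a i * b j - a j * b
   i)^2. *)
suff : 0 <= P * Q + Q * P - (S * S) *+ 2 by rewrite expr2; lra.
rewrite /P /Q /S !big_distrlr /= -big_split -sumrMnl -sumrB /=.
apply: sumr_ge0 => i _; rewrite -big_split -sumrMnl -sumrB /=.
apply: sumr_ge0 => j _.
rewrite (_ : _ - _ = w i * w j * (a i * b j - a j * b i) ^+ 2); last by ring.
by rewrite mulr_ge0 ?sqr_ge0 ?mulr_ge0.
Qed.

(* A nonnegative function is a positive combination of indicators of nested
   sets; the induction peels off the largest of these sets, the support. *)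
Lemma coarea_le (R : realFieldType) (V : finType) (w : V -> V ->
  R) (nu : V -> R)
    (c : R) (S : {set V}) :
  (forall A : {set V}, A \subset S ->
     c * (\sum_(x in A) nu x) <= \sum_(x in A) \sum_(y in ~: A) w x y) ->
  forall g : V -> R, (forall x, 0 <= g x) -> (forall x, x \notin S ->
    g x = 0) ->
  c * (\sum_x g x * nu x) <= \sum_x \sum_y w x y * Num.max (g x - g y) 0.
Proof.
move=> cut_le g; have [n] := ubnP #|[set x | 0 < g x]|.
elim: n g => // n IHn g ltn g_ge0 gS; set A := [set x | 0 < g x] in ltn.
have gA x : x \notin A -> g x = 0.
  by rewrite inE lt0r g_ge0 andbT negbK => /eqP.
have [A0|[x0 x0A]] := set_0Vmem A.
  have g0 x : g x = 0 by apply: gA; rewrite A0 inE.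
  rewrite [X in c * X]big1 => [|x _]; last by rewrite g0 mul0r.
  rewrite mulr0 big1 // => x _; rewrite big1 // => y _.
  by rewrite !g0 subrr maxxx mulr0.
(* [t] is the least positive value of [g]. Lowering [g] by [t] on its support [A] keeps it
   nonnegative and removes [x1] from the support. *)
case: (@arg_minP _ _ _ x0 (mem A) g x0A) => x1 x1A gmin; set t := g x1 in gmin.
have {}x1A : x1 \in A by [].
have t_gt0 : 0 < t by move: x1A; rewrite inE.
pose g' x := g x - t *+ (x \in A).
have g'_ge0 x : 0 <= g' x.
  rewrite /g'; case: (boolP (x \in A)) => [/gmin|_]; first by rewrite subr_ge0.
  by rewrite subr0.
have g'S x : x \notin S -> g' x = 0.
  move=> /gS gx; have xA : x \notin A by rewrite inE gx ltxx.
  by rewrite /g' gx (negPf xA) subr0.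
have {IHn} IH : c * (\sum_x g' x * nu x) <=
  \sum_x \sum_y w x y * Num.max (g' x - g' y) 0.
  apply: IHn => //; rewrite ltnS in ltn; apply: leq_trans ltn;
    apply/proper_card/properP; split.
    apply/subsetP=> x; rewrite inE /g' => gx; apply/negPn/negP => xA.
    by move: gx; rewrite gA // (negPf xA) subr0 ltxx.
  by exists x1 => //; rewrite inE /g' x1A subrr ltxx.
have AS : A \subset S.
  by apply/subsetP=> x; rewrite inE; apply: contraTT => /gS ->; rewrite ltxx.
have -> : \sum_x g x * nu x = \sum_x g' x * nu x + t * \sum_(x in A) nu x.
  rewrite mulr_sumr [X in _ + X]big_mkcond -big_split; apply: eq_bigr => x _ /=.
  by rewrite /g'; case: (x \in A); rewrite ?mulr1n ?mulr0n; ring.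
(* Peeling off [t] alters a positive part only when x is in [A] and y is not. There [g y = 0] and
   the loss is exactly [t], so the total loss is [t] times the cut of [A]. *)
have -> : \sum_x \sum_y w x y * Num.max (g x - g y) 0 =
    \sum_x \sum_y w x y * Num.max (g' x - g' y) 0
    + t * \sum_(x in A) \sum_(y in ~: A) w x y.
  rewrite mulr_sumr [X in _ + X]big_mkcond -big_split; apply: eq_bigr => x _ /=.
  rewrite (_ : (if _ then _ else _) =
    \sum_y if (x \in A) && (y \notin A) then t * w x y else 0); last first.
    case: ifP => _; last by rewrite big1.
    by rewrite mulr_sumr big_mkcond; apply: eq_bigr => y _; rewrite inE.
  rewrite -big_split; apply: eq_bigr => y _ /=.
  have := g'_ge0 x; have := g'_ge0 y; rewrite /g'.
  case: (boolP (x \in A)) => [xA|/gA ->];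
    case: (boolP (y \in A)) => [yA|/gA ->] /=.
  - by rewrite addr0 => _ _; congr (_ * Num.max _ _); ring.
  - rewrite !subr0 mulr1n => _ gt; rewrite !max_l //; ring.
  - by move=> ? _; rewrite addr0 !max_r // ?subr0 ?sub0r ?oppr_le0 //; lra.
  - by rewrite addr0 !subr0.
by rewrite mulrDr lerD // mulrCA ler_pM2l // cut_le.
Qed.

Lemma set2_eq (T : finType) (a b x y : T) :
  [set a; b]%SET = [set x; y]%SET -> (a = x /\ b = y) \/ (a = y /\ b = x).
Proof.
move=> E.
have : a \in [set x; y]%SET by rewrite -E !inE eqxx.
have : b \in [set x; y]%SET by rewrite -E !inE eqxx orbT.
have : x \in [set a; b]%SET by rewrite E !inE eqxx.
have : y \in [set a; b]%SET by rewrite E !inE eqxx orbT.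
rewrite !inE => /orP[]/eqP ? /orP[]/eqP ? /orP[]/eqP ? /orP[]/eqP ?;
  by [left; split; congruence | right; split; congruence].
Qed.

Lemma inf_ge0 (R : realType) (E : classical_sets.set R) :
  (forall x, E x -> 0 <= x) -> 0 <= inf E.
Proof.
(* The empty set has infimum 0 by convention. *)
move=> E_ge0; have [->|E0] := eqVneq E classical_sets.set0;
  first by rewrite inf0.
by apply: lb_le_inf => //; apply/classical_sets.set0P.
Qed.

(** * Weights, measure and cuts of the graph on the closure *)

Section Graph.
Variables (R : realType) (V : finType) (mu : V -> V -> R).
Hypothesis mu_ge0 : forall x y, 0 <= mu x y.
Hypothesis mu_sym : forall x y, mu x y = mu y x.
Variable Omega : {set V}.

Local Notation vb := (vbdry mu Omega).
Local Notation vc := (vclos mu Omega).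
Local Notation m := (vmeas mu Omega).

(* The weights of the graph with edge set E(Omega, vclos), extended by 0. *)
Definition tweight (x y : V) : R :=
  if (x \in Omega) || (y \in Omega) then mu x y else 0.
Local Notation w := tweight.

Lemma tweight_ge0 x y : 0 <= w x y.
Proof. by rewrite /w; case: ifP. Qed.

Lemma tweight_sym x y : w x y = w y x.
Proof. by rewrite /w orbC mu_sym. Qed.

Lemma tweight_gt0 x y : (0 < w x y) =
  (0 < mu x y) && ((x \in Omega) || (y \in Omega)).
Proof. by rewrite /w; case: ifP => _; rewrite ?andbT // ltxx andbF. Qed.

Lemma tweight_gt0_vclos x y : 0 < w x y -> x \in vc.
Proof.
rewrite tweight_gt0 /vclos !inE => /andP[mxy].
have [//|xO /=] := boolP (x \in Omega); move=> yO.
by apply/existsP; exists y; rewrite yO.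
Qed.

Lemma tweight_eq0 x y : x \notin vc -> w x y = 0.
Proof.
move=> xc; apply/eqP; rewrite eq_le tweight_ge0 andbT leNgt.
by apply: contra xc => /tweight_gt0_vclos.
Qed.

Lemma tweight_ngt0 x y : ~~ (0 < w x y) -> w x y = 0.
Proof. by rewrite lt0r tweight_ge0 andbT negbK => /eqP. Qed.

(** Both cases of the measure become one weighted degree over all of [V]: non-edges weigh 0, and
    [tweight] drops edges with both ends outside [Omega]. *)
Lemma vmeasE x : m x = \sum_y w x y.
Proof.
rewrite /vmeas /w; case: ifP => xO /=.
  rewrite big_mkcond; apply: eq_bigr => y _; case: ifP => //.
  by rewrite /adj mu_sym lt0r mu_ge0 andbT => /negbFE/eqP.
rewrite big_mkcond; apply: eq_bigr => y _ /=; case: (y \in Omega) => //=.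
by rewrite /adj mu_sym lt0r mu_ge0 andbT; case: eqP.
Qed.

Lemma vmeas_ge0 x : 0 <= m x.
Proof. by rewrite vmeasE sumr_ge0 // => y _; exact: tweight_ge0. Qed.

Lemma vmeas_bdry_gt0 z : z \in vb -> 0 < m z.
Proof.
rewrite inE => /andP[zO /existsP[y /andP[yO zy]]].
rewrite vmeasE (bigD1 y) //= ltr_pwDl ?tweight_gt0 ?yO ?orbT ?andbT //.
by rewrite sumr_ge0 // => i _; exact: tweight_ge0.
Qed.

Lemma meas_ge0 A : 0 <= meas mu Omega A.
Proof. by rewrite sumr_ge0 // => x _; exact: vmeas_ge0. Qed.

Lemma mem_tilde_edges a b :
  ([set a; b]%SET \in tilde_edges mu Omega) = (0 < w a b).
Proof.
apply/imset2P/idP => [[x y xO]|wab].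
  rewrite inE => /andP[yc xy] /set2_eq[] [-> ->]; last rewrite tweight_sym.
    by rewrite tweight_gt0 xO andbT.
  by rewrite tweight_gt0 xO andbT.
wlog aO : a b wab / a \in Omega => [IH|].
  move: (wab); rewrite tweight_gt0 => /andP[_ /orP[aO|bO]]; first exact: IH.
  by rewrite setUC; apply: IH; rewrite // tweight_sym.
exists a b => //; rewrite inE (@tweight_gt0_vclos b a) 1?tweight_sym //=.
by move: wab; rewrite tweight_gt0 => /andP[].
Qed.

Lemma mem_edge_bdry (A : {set V}) x y :
  ([set x; y]%SET \in edge_bdry mu Omega A) =
    ((x \in A) != (y \in A)) && (0 < w x y).
Proof.
rewrite /edge_bdry in_setI mem_tilde_edges; case: (boolP (0 < w x y));
  last first.
  by rewrite !andbF.
move=> wxy; rewrite !andbT; have : 0 < mu x y by move: wxy;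
  rewrite tweight_gt0 => /andP[].
move=> mxy; apply/imset2P/idP => [[a b aA]|].
  by rewrite !inE => /andP[bA _] /set2_eq[] [-> ->]; rewrite aA (negPf bA).
case: (boolP (x \in A)) => xA; case: (boolP (y \in A)) => yA // _.
  by exists x y; rewrite // !inE yA.
by rewrite setUC; exists y x; rewrite // !inE xA /adj mu_sym.
Qed.

(** An edge of the cut has exactly one endpoint in [A], so orienting it outwards lists it once, just
    as the rank comparison does. *)
Lemma edge_weight_bdry (A : {set V}) :
  edge_weight mu (edge_bdry mu Omega A) = \sum_(x in A) \sum_(y in ~: A) w x y.
Proof.
pose T (b : V -> V ->
  bool) x y := if b x y && (x \in A) && (y \notin A) then w x y else 0.
pose le (x y : V) := (enum_rank x <= enum_rank y)%N.
(* A pair ordered by rank leaves [A] either from x or from y. Exchanging the variables in the second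
   kind yields outward pairs in both rank orders, and distinct vertices satisfy exactly one of
   them. *)
transitivity (\sum_x \sum_y (T le x y + T (fun a b => le b a) y x)).
  apply: eq_bigr => x _; rewrite big_mkcond; apply: eq_bigr => y _.
  rewrite mem_edge_bdry /T /le [w y x]tweight_sym; case: (boolP (0 < w x y));
    last first.
    by move/tweight_ngt0 => ->; rewrite !andbF !if_same addr0.
  rewrite tweight_gt0 /w andbT => /andP[_ ->].
  by case: (x \in A); case: (y \in A); case: (_ <= _)%N => /=;
    rewrite ?addr0 ?add0r.
under eq_bigr do rewrite big_split.
rewrite big_split /= [X in _ + X]exchange_big -big_split /= [RHS]big_mkcond.
apply: eq_bigr => x _; rewrite -big_split /=.
rewrite (_ : (if _ then _ else _) =
    \sum_y if (x \in A) && (y \notin A) then w x y else 0); last first.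
  case: ifP => _; last by rewrite big1.
  by rewrite big_mkcond; apply: eq_bigr => y _; rewrite inE.
apply: eq_bigr => y _; rewrite /T /le.
case: (boolP (x \in A)) => xA; case: (boolP (y \in A)) => yA /=;
  rewrite ?andbF ?addr0 //=.
rewrite !andbT; have xy : x != y by apply: contraNneq yA => <-.
have : enum_rank x != enum_rank y :> nat.
  by apply: contraNneq xy => /ord_inj/enum_rank_inj->.
by case: ltngtP; rewrite ?addr0 ?add0r.
Qed.

Lemma cut_ge0 (A : {set V}) : 0 <= edge_weight mu (edge_bdry mu Omega A).
Proof.
by rewrite edge_weight_bdry; do 2![apply: sumr_ge0 => ? _]; exact: tweight_ge0.
Qed.

Lemma cheeger_ge0 : 0 <= cheeger mu Omega.
Proof.
by apply: inf_ge0 => r [A [_ _ _ ->]]; rewrite divr_ge0 ?cut_ge0 ?meas_ge0.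
Qed.

Lemma jammes_cheeger_ge0 : 0 <= jammes_cheeger mu Omega.
Proof.
by apply: inf_ge0 => r [A [_ _ _ ->]]; rewrite divr_ge0 ?cut_ge0 ?meas_ge0.
Qed.

(** Clearing the denominator extends the bound to sets of measure 0, in particular the empty set, so
    every level set in the coarea argument is covered. *)
Lemma cheeger_cut (A : {set V}) : A \subset vc ->
  meas mu Omega A <= 2^-1 * meas mu Omega vc ->
  cheeger mu Omega * meas mu Omega A <= edge_weight mu (edge_bdry mu Omega A).
Proof.
move=> Ac Am; have := meas_ge0 A; rewrite le_eqVlt => /orP[/eqP<-|A_gt0].
  by rewrite mulr0 cut_ge0.
rewrite -ler_pdivlMr //; apply: ge_inf.
  by exists 0 => r [B [_ _ _ ->]]; rewrite divr_ge0 ?cut_ge0 ?meas_ge0.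
exists A; split=> //; apply: contraTneq A_gt0 => ->.
by rewrite /meas big_set0 ltxx.
Qed.

(** Sets that miss the boundary do not enter the infimum; for them the left side is 0. *)
Lemma jammes_cheeger_cut (A : {set V}) : A \subset vc ->
  meas mu Omega A <= 2^-1 * meas mu Omega vc ->
  jammes_cheeger mu Omega * meas mu Omega (A :&: vb)%SET <=
    edge_weight mu (edge_bdry mu Omega A).
Proof.
move=> Ac Am; have := meas_ge0 (A :&: vb)%SET.
rewrite le_eqVlt => /orP[/eqP<-|A_gt0]; first by rewrite mulr0 cut_ge0.
rewrite -ler_pdivlMr //; apply: ge_inf.
  by exists 0 => r [B [_ _ _ ->]]; rewrite divr_ge0 ?cut_ge0 ?meas_ge0.
exists A; split=> //; apply: contraTneq A_gt0 => ->.
by rewrite /meas big_set0 ltxx.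
Qed.

(** * The unnormalized Laplacian and Green's formula *)

(* Equal to - m Delta F on Omega and to m dF/dn on the boundary. *)
Definition tlap (F : V -> R) (x : V) : R := \sum_y w x y * (F x - F y).

(** Splitting [G x - G y] gives two sums that agree after exchanging x and y. The factor 2 counts
    each edge in both directions; boundary terms are already contained in [tlap]. *)
Lemma tlap_green (F G : V -> R) :
  \sum_x \sum_y w x y * ((F x - F y) * (G x - G y)) = 2 * \sum_x G x * tlap F x.
Proof.
have -> : \sum_x \sum_y w x y * ((F x - F y) * (G x - G y)) =
    \sum_x \sum_y w x y * (F x - F y) * G x +
      \sum_x \sum_y w x y * (F y - F x) * G y.
  rewrite -big_split; apply: eq_bigr => x _; rewrite -big_split.
  by apply: eq_bigr => y _ /=; ring.
rewrite [X in _ + X]exchange_big /= -big_split mulr_sumr;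
  apply: eq_bigr => x _ /=.
rewrite -big_split mulrCA mulr_sumr mulr_sumr; apply: eq_bigr => y _ /=.
by rewrite [w y x]tweight_sym; ring.
Qed.

Lemma tlap_sym (F G : V -> R) : \sum_x G x * tlap F x = \sum_x F x * tlap G x.
Proof.
have /mulfI : (2 : R) != 0 by rewrite pnatr_eq0.
apply; rewrite -!tlap_green; apply: eq_bigr => x _; apply: eq_bigr => y _.
by rewrite [_ * (G x - _)]mulrC.
Qed.

Lemma energy_ge0 (F : V -> R) : 0 <= \sum_x F x * tlap F x.
Proof.
rewrite -(pmulr_rge0 _ (ltr0Sn _ 1)) -tlap_green.
do 2![apply: sumr_ge0 => ? _]; by rewrite -expr2 mulr_ge0 ?tweight_ge0 ?sqr_ge0.
Qed.

Lemma tlap_vclos (F : V -> R) x : x \notin vc -> tlap F x = 0.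
Proof. by move=> xc; rewrite /tlap big1 // => y _;
  rewrite tweight_eq0 // mul0r. Qed.

(** * The Cheeger-type bound for one truncated function *)

Lemma cheeger_jammes_le (F : V -> R) (a : R) :
  (forall x, x \in Omega -> tlap F x = 0) ->
  (forall z, z \in vb -> tlap F z = a * (m z * F z)) ->
  (forall x, x \notin vc -> F x = 0) ->
  (exists2 z, z \in vb & 0 < F z) ->
  meas mu Omega [set x | 0 < F x]%SET <= 2^-1 * meas mu Omega vc ->
  2^-1 * cheeger mu Omega * jammes_cheeger mu Omega <= a.
Proof.
move=> F_harm F_bdry F_out [z0 z0b Fz0] F_half.
pose f x : R := Num.max (F x) 0; pose g x : R := f x ^+ 2.
have f_ge0 x : 0 <= f x by rewrite /f le_max lexx orbT.
pose P : R := \sum_x g x * m x.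
pose Q : R := \sum_x g x * (m x *+ (x \in vb)).
pose C := \sum_x \sum_y w x y * Num.max (g x - g y) 0.
set S := [set x | 0 < F x]%SET in F_half.
have S_vc : S \subset vc.
  by apply/subsetP => x; rewrite inE; apply: contraTT => /F_out->; rewrite ltxx.
(* Every level set of [g] lies in [S], so it inherits the half-measure constraint. *)
have sub_half (A : {set V}) : A \subset S ->
  meas mu Omega A <= 2^-1 * meas mu Omega vc.
  move=> /setIidPr AS; apply: le_trans F_half.
  rewrite /meas [leRHS](big_setID A) /= AS lerDl.
  by apply: sumr_ge0 => x _; exact: vmeas_ge0.
have gS x : x \notin S -> g x = 0.
  by rewrite inE /g /f -leNgt => /max_r->; rewrite expr0n.
have g_ge0 x : 0 <= g x by rewrite sqr_ge0.
have CP : cheeger mu Omega * P <= C.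
  apply: (@coarea_le _ _ _ _ _ S) => // A AS; rewrite -edge_weight_bdry.
  exact: cheeger_cut (subset_trans AS S_vc) (sub_half _ AS).
have CQ : jammes_cheeger mu Omega * Q <= C.
  apply: (@coarea_le _ _ _ _ _ S) => // A AS; rewrite -edge_weight_bdry.
  have := jammes_cheeger_cut (subset_trans AS S_vc) (sub_half _ AS).
  congr (_ * _ <= _); rewrite /meas [LHS]big_mkcond [RHS]big_mkcond.
  by apply: eq_bigr => x _; rewrite inE; case: (x \in A); case: (x \in vb).
have Q_gt0 : 0 < Q.
  rewrite /Q (bigD1 z0) //= z0b ltr_pwDl //.
    by rewrite mulr_gt0 ?vmeas_bdry_gt0 // exprn_gt0 // /f max_l // ltW.
  by apply: sumr_ge0 => x _; rewrite mulr_ge0 ?mulrn_wge0 ?vmeas_ge0.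
have P_gt0 : 0 < P.
  apply: lt_le_trans Q_gt0 _; apply: ler_sum => x _; rewrite ler_wpM2l //.
  by case: (x \in vb); rewrite ?mulr0n ?vmeas_ge0.
(* The summand is [w x y] times |g x - g y|. By symmetry of the weights, its sum over ordered pairs
   is twice the sum of the positive parts. *)
have C2 : \sum_x \sum_y w x y * (`|f x - f y| * (f x + f y)) = 2 * C.
  rewrite mulr_natl mulr2n [in RHS]/C [X in _ = X + _]exchange_big -big_split.
  apply: eq_bigr => x _; rewrite -big_split; apply: eq_bigr => y _ /=.
  rewrite [w y x]tweight_sym -mulrDr; congr (_ * _).
  rewrite -[f x + f y]ger0_norm ?addr_ge0 // -normrM -subr_sqr -/(g x) -/(g y).
  case: (lerP (g x) (g y)) => gxy.
    by rewrite max_l ?subr_ge0 // max_r ?subr_le0 // addr0.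
  by rewrite max_r ?subr_le0 ?ltW // max_l ?subr_ge0 ?ltW // add0r.
(* Summed over ordered pairs, so this is twice the Dirichlet energy of [f]. *)
pose D := \sum_x \sum_y w x y * (f x - f y) ^+ 2.
(* Truncation gives (f x - f y)^2 <= (F x - F y) * (f x - f y) pointwise; Green's formula for the
   pair [F], [f] then leaves only boundary terms. *)
have DQ : D <= 2 * (a * Q).
  have -> : a * Q = \sum_x f x * tlap F x.
    rewrite mulr_sumr; apply: eq_bigr => x _.
    have [xb|xb] := boolP (x \in vb).
      rewrite F_bdry // mulr1n /g; have [Fx|Fx] := lerP (F x) 0.
        by rewrite /f max_r //; ring.
      by rewrite /f max_l ?ltW //; ring.
    rewrite mulr0 mulr0; have [xO|xO] := boolP (x \in Omega).
      by rewrite F_harm // mulr0.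
    by rewrite tlap_vclos ?mulr0 // /vclos inE negb_or xO.
  rewrite -tlap_green; apply: ler_sum => x _; apply: ler_sum => y _.
  rewrite ler_wpM2l ?tweight_ge0 // /f.
  have [Fx|Fx] := lerP (F x) 0; have [Fy|Fy] := lerP (F y) 0; nra.
(* The factor 4 combines (s + t)^2 <= 2 * (s^2 + t^2) with the two sums of [g] against the weighted
   degree, each equal to [P]. *)
have CD : (2 * C) ^+ 2 <= D * (4 * P).
  rewrite -C2 pair_bigA /=.
  have /le_trans := weighted_cauchy_schwarz (fun p : V * V => `|f p.1 - f p.2|)
    (fun p => f p.1 + f p.2) (fun p => tweight_ge0 p.1 p.2); apply.
  apply: ler_pM.
  - by apply: sumr_ge0 => p _; rewrite mulr_ge0 ?tweight_ge0 ?sqr_ge0.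
  - by apply: sumr_ge0 => p _; rewrite mulr_ge0 ?tweight_ge0 ?sqr_ge0.
  - rewrite /D pair_bigA /=; apply: ler_sum => p _.
    by rewrite real_normK ?num_real.
  have -> : 4 * P = \sum_x \sum_y w x y * (2 * (g x + g y)).
    under [RHS]eq_bigr do (under eq_bigr do rewrite !mulrDr; rewrite big_split).
    rewrite big_split /= [X in _ + X]exchange_big -big_split mulr_sumr /=.
    apply: eq_bigr => x _; rewrite -big_split vmeasE !mulr_sumr /=.
    by apply: eq_bigr => y _; rewrite [w y x]tweight_sym; ring.
  rewrite pair_bigA; apply: ler_sum => -[x y] _ /=.
  by rewrite ler_wpM2l ?tweight_ge0 // /g; have := sqr_ge0 (f x - f y); nra.
have h0 := cheeger_ge0; have hJ0 := jammes_cheeger_ge0.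
have C0 : 0 <= C by apply: le_trans CP; rewrite mulr_ge0 // ltW.
have hh : (cheeger mu Omega * P) * (jammes_cheeger mu Omega * Q) <= C * C.
  by rewrite ler_pM // mulr_ge0 // ltW.
have PQ : 0 < P * Q by rewrite mulr_gt0.
(* After multiplying by P * Q, the chain is h * h_J * P * Q <= C^2 <= D * P <= 2 * a * P * Q. *)
rewrite -(ler_pM2r PQ).
have : D * (4 * P) <=
  2 * (a * Q) * (4 * P) by rewrite ler_wpM2r // mulr_ge0 // ltW.
move: CD hh; lra.
Qed.

(** * Existence and uniqueness of harmonic extensions *)

Section HarmonicExtension.
Hypothesis connected_tilde : tilde_connected mu Omega.
Hypothesis bdry_neq0 : vb != set0.

Local Notation cT := (closT mu Omega).
Local Notation bT := (bdryT mu Omega).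
Local Notation incl := (@bdry_incl R V mu Omega).

(** All terms of the energy are nonnegative, so each vanishes: [F] agrees across every edge, hence
    along every path. *)
Lemma energy_eq0_const (F : V -> R) :
  \sum_x F x * tlap F x = 0 -> forall x y, x \in vc -> y \in vc -> F x = F y.
Proof.
move=> E0 x y xc yc; have /connectP[p] := connected_tilde xc yc.
have E0' : \sum_x \sum_y w x y * ((F x - F y) * (F x - F y)) = 0.
  by rewrite tlap_green E0 mulr0.
have wF_ge0 a b : 0 <= w a b * ((F a - F b) * (F a - F b)).
  by rewrite -expr2 mulr_ge0 ?tweight_ge0 ?sqr_ge0.
have Fedge a b : 0 < w a b -> F a = F b.
  move=> wab; have /psumr_eq0P := E0'.
  move=> /(_ (fun i _ => sumr_ge0 _ (fun j _ => wF_ge0 i j)) a isT)/psumr_eq0P.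
  move=> /(_ (fun j _ => wF_ge0 a j) b isT)/eqP.
  by rewrite mulf_eq0 gt_eqF //= mulf_eq0 orbb subr_eq0 => /eqP.
elim: p x {xc} => [|b p IHp] a /=; first by move=> _ ->.
by rewrite mem_tilde_edges => /andP[/Fedge-> /IHp].
Qed.

Lemma vclos_cases x : x \in vc -> x \in Omega \/ x \in vb.
Proof. by rewrite /vclos in_setU => /orP. Qed.

Lemma vbdry_vclos x : x \in vb -> x \in vc.
Proof. by rewrite /vclos in_setU orbC => ->. Qed.

Lemma vbdry_notin x : x \in vb -> x \notin Omega.
Proof. by rewrite inE => /andP[]. Qed.

(** An energy argument in place of the maximum principle: at each point [F] or [tlap F] vanishes, so
    the energy is 0 and [F] equals its value at a boundary vertex. *)
Lemma harmonic_eq0 (F : V -> R) :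
  (forall x, x \in Omega -> tlap F x = 0) -> (forall z, z \in vb -> F z = 0) ->
  forall x, x \in vc -> F x = 0.
Proof.
move=> F_harm F_bdry x xc; have [z zb] := set0Pn _ bdry_neq0.
rewrite -(F_bdry _ zb); apply: energy_eq0_const (vbdry_vclos zb) => //.
apply: big1 => y _; have [yc|yc] := boolP (y \in vc);
  last by rewrite tlap_vclos ?mulr0.
by have [/F_harm->|/F_bdry->] := vclos_cases yc; rewrite ?mulr0 ?mul0r.
Qed.

(** Extension by 0 trades sums over the subtype for sums over [V]; [tweight] vanishes off the
    closure, so the added values do not affect [tlap]. *)
Definition ext0 (u : {ffun cT -> R^o}) (x : V) : R := oapp u 0 (insub x).

Lemma ext0_val u (c : cT) : ext0 u (val c) = u c.
Proof. by rewrite /ext0 valK. Qed.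

Lemma ext0_out u x : x \notin vc -> ext0 u x = 0.
Proof. by move=> xc; rewrite /ext0 insubN. Qed.

Lemma ext0_linear a u v x : ext0 (a *: u + v) x = a * ext0 u x + ext0 v x.
Proof. by rewrite /ext0; case: insubP => [c _ _|_] /=;
  rewrite ?ffunE // mulr0 addr0. Qed.

Lemma tlap_linear a F G H x : (forall y, H y = a * F y + G y) ->
  tlap H x = a * tlap F x + tlap G x.
Proof.
move=> HE; rewrite /tlap mulr_sumr -big_split; apply: eq_bigr => y _ /=.
by rewrite !HE; ring.
Qed.

Lemma laplacian_eq0 (u : {ffun cT -> R^o}) (x : cT) : val x \in Omega ->
  laplacian u x = 0 <-> tlap (ext0 u) (val x) = 0.
Proof.
move=> xO; have -> : laplacian u x = - ((m (val x))^-1 * tlap (ext0 u) (val x)).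
  rewrite -mulrN; congr (_ * _); rewrite /tlap -sumrN.
  transitivity (\sum_(y : cT | adj mu (val y) (val x))
      w (val x) (val y) * (ext0 u (val y) - ext0 u (val x))).
    by apply: eq_bigr => y _; rewrite !ext0_val /w xO.
  rewrite -(big_sub_cond _ (fun y => adj mu y (val x))
     (fun y => w (val x) y * (ext0 u y - ext0 u (val x)))) big_mkcond.
  apply: eq_bigr => y _; rewrite -mulrN opprB; case: ifP => // /negP.
  have [wxy|/tweight_ngt0-> //] := boolP (0 < w (val x) y);
    last by rewrite mul0r.
  case; apply/andP; split; first by apply: (@tweight_gt0_vclos _ (val x));
    rewrite tweight_sym.
  by move: wxy; rewrite tweight_gt0 /adj mu_sym => /andP[].
split=> [/eqP|->]; last by rewrite mulr0 oppr0.
rewrite oppr_eq0 mulf_eq0 invr_eq0 => /orP[|/eqP//].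
(* If the measure of x is 0, the inverse is the default 0; but then all weights at x vanish, and so
   does [tlap]. *)
rewrite vmeasE => /eqP/psumr_eq0P m0; apply: big1 => y _.
by rewrite m0 ?mul0r // => i _; exact: tweight_ge0.
Qed.

Lemma normal_derivativeE (u : {ffun cT -> R^o}) (z : bT) :
  m (val z) * normal_derivative u z = tlap (ext0 u) (val z).
Proof.
have zO := vbdry_notin (valP z).
rewrite mulVKf ?gt_eqF ?vmeas_bdry_gt0 ?(valP z) //.
transitivity (\sum_(y : cT | (val y \in Omega) && adj mu (val y) (val z))
    w (val z) (val y) * (ext0 u (val z) - ext0 u (val y))).
  apply: eq_bigr => y /andP[yO _].
  by rewrite -(ext0_val u (incl z)) -(ext0_val u y) /w yO orbT.
rewrite -(big_sub_cond _ (fun y => (y \in Omega) && adj mu y (val z))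
   (fun y => w (val z) y * (ext0 u (val z) - ext0 u y))) big_mkcond.
apply: eq_bigr => y _; case: ifP => // /negP.
have [wzy|/tweight_ngt0-> //] := boolP (0 < w (val z) y); last by rewrite mul0r.
case; apply/andP; split; first by apply: (@tweight_gt0_vclos _ (val z));
  rewrite tweight_sym.
by move: wzy; rewrite tweight_gt0 (negPf zO) /adj mu_sym andbC.
Qed.

Lemma harmonic_extensionP (phi : {ffun bT -> R^o}) u :
  is_harmonic_extension phi u <->
  (forall x, x \in Omega -> tlap (ext0 u) x = 0) /\
  (forall z : bT, ext0 u (val z) = phi z).
Proof.
have bE z : u (incl z) = ext0 u (val z) by rewrite -(ext0_val u (incl z)).
split=> -[harm bdry]; split=> [x xO|z].
- have xc : x \in vc by rewrite /vclos in_setU xO.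
  by apply/(@laplacian_eq0 u (exist _ x xc)) => //; exact: harm.
- by rewrite -bE.
- by apply/laplacian_eq0 => //; exact: harm.
- by rewrite bE.
Qed.

(** The Dirichlet problem is a square linear system with operator [T]. Uniqueness makes its kernel
    trivial, so in finite dimension it is solvable for every right-hand side. *)
Lemma harmonic_extension_exists (phi : {ffun bT -> R^o}) :
  exists u, is_harmonic_extension phi u.
Proof.
pose T (u : {ffun cT -> R^o}) : {ffun cT -> R^o} :=
  [ffun c => if val c \in Omega then tlap (ext0 u) (val c) else u c].
have T_lin : linear T.
  move=> a u v; apply/ffunP => c; rewrite !ffunE; case: ifP => // _.
  exact/tlap_linear/ext0_linear.
pose TL := GRing.isLinear.Build _ _ _ _ T T_lin.
pose Tl : {linear {ffun cT -> R^o} -> {ffun cT -> R^o}} := HB.pack T TL.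
have kerT : lker (linfun Tl) == 0%VS.
  apply/eqP/vspaceP => u; rewrite memv_ker memv0 lfunE /=.
  apply/eqP/eqP => [/ffunP Tu0|->]; last exact: (linear0 Tl).
  have u0 := @harmonic_eq0 (ext0 u) _ _.
  apply/ffunP => c; rewrite -ext0_val ffunE u0 ?(valP c) // => [x xO|z zb].
    have xc : x \in vc by rewrite /vclos in_setU xO.
    by have := Tu0 (exist _ x xc); rewrite !ffunE /= xO.
  have := Tu0 (exist _ z (vbdry_vclos zb)).
  by rewrite !ffunE /= (negPf (vbdry_notin zb)) -ext0_val.
pose rhs : {ffun cT -> R^o} := [ffun c => oapp phi 0 (insub (val c))].
have := lker0_lfunVK kerT rhs; set u := (_^-1)%VF _;
  rewrite lfunE /= => /ffunP Tu.
exists u; apply/harmonic_extensionP; split=> [x xO|z].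
  have xc : x \in vc by rewrite /vclos in_setU xO.
  have := Tu (exist _ x xc); rewrite !ffunE /= xO => ->.
  by rewrite insubN //; apply: contraTN xO; exact: vbdry_notin.
have := Tu (incl z); rewrite !ffunE /= (negPf (vbdry_notin (valP z))).
by rewrite -ext0_val /= valK.
Qed.

Definition hext (phi : {ffun bT -> R^o}) : V -> R :=
  ext0 (harmonic_extension phi).

Lemma hext_spec phi :
  [/\ forall x, x \in Omega -> tlap (hext phi) x = 0,
      forall z : bT, hext phi (val z) = phi z
    & forall x, x \notin vc -> hext phi x = 0].
Proof.
have /harmonic_extensionP[harm bdry] :
  is_harmonic_extension phi (harmonic_extension phi).
  exact: classical_sets.xgetPex (harmonic_extension_exists phi).
by split=> // x; exact: ext0_out.
Qed.

Lemma DtN_E phi (z : bT) : m (val z) * DtN phi z = tlap (hext phi) (val z).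
Proof. by rewrite ffunE normal_derivativeE. Qed.

Lemma hext_unique (phi : {ffun bT -> R^o}) F : (forall x, x \in Omega ->
  tlap F x = 0) ->
  (forall z : bT, F (val z) = phi z) -> forall x, x \in vc -> F x = hext phi x.
Proof.
move=> F_harm F_bdry x xc; have [harm bdry out] := hext_spec phi.
have dE y : F y - hext phi y = - 1 * hext phi y + F y by ring.
apply/eqP; rewrite -subr_eq0; apply/eqP.
apply: (@harmonic_eq0 (fun y => F y - hext phi y)) => // [y yO|z zb].
  by rewrite (tlap_linear _ dE) harm // F_harm // mulr0 addr0.
by have := F_bdry (exist _ z zb); rewrite -bdry /= => ->; rewrite subrr.
Qed.

(** * The Dirichlet-to-Neumann operator: linearity, symmetry and kernel *)

Lemma DtN_linear : linear (@DtN R V mu Omega).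
Proof.
move=> a phi psi; apply/ffunP => z.
apply: (mulfI (lt0r_neq0 (vmeas_bdry_gt0 (valP z)))).
have [h1 b1 o1] := hext_spec phi; have [h2 b2 o2] := hext_spec psi.
have [h b o] := hext_spec (a *: phi + psi).
pose F x := a * hext phi x + hext psi x.
(* By uniqueness, the combination of the two extensions is the extension of the combination. *)
have FE x : hext (a *: phi + psi) x = F x.
  have [xc|xc] := boolP (x \in vc);
    last by rewrite /F o // o1 // o2 // mulr0 addr0.
  apply/esym; apply: hext_unique xc => [y yO|y].
    by rewrite (@tlap_linear a (hext phi) (hext psi)) // h1 // h2 // mulr0 addr0.
  by rewrite /F b1 b2 !ffunE.
rewrite DtN_E (tlap_linear _ FE) -!DtN_E !ffunE.
by rewrite mulrDr; congr (_ + _); rewrite mulrCA.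
Qed.

Definition bform (phi psi : {ffun bT -> R^o}) : R :=
  \sum_(z : bT) m (val z) * (phi z * psi z).

(** Harmonicity removes the points of [Omega] from the energy pairing. Symmetry and nonnegativity of
    [DtN] are read off from the right side. *)
Lemma bform_DtN phi psi :
  bform (DtN phi) psi = \sum_x hext psi x * tlap (hext phi) x.
Proof.
have [h1 b1 o1] := hext_spec phi; have [h2 b2 o2] := hext_spec psi.
transitivity (\sum_(x in vb) hext psi x * tlap (hext phi) x).
  rewrite big_sub; apply: eq_bigr => z _.
  by rewrite -[psi z]b2 mulrA DtN_E mulrC.
rewrite big_mkcond; apply: eq_bigr => x _; case: ifP => // /negbT xb.
have [xc|xc] := boolP (x \in vc); last by rewrite tlap_vclos // mulr0.
by have [/h1->|xb'] := vclos_cases xc; rewrite ?mulr0 // xb' in xb *.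
Qed.

Lemma bform_sym phi psi : bform phi psi = bform psi phi.
Proof. by apply: eq_bigr => z _; rewrite [phi z * _]mulrC. Qed.

Lemma bform_linear psi : linear_for *%R (bform^~ psi).
Proof.
move=> a u v; rewrite /bform mulr_sumr -big_split; apply: eq_bigr => z _ /=.
by rewrite !ffunE /= -[a *: _]/(a * _); ring.
Qed.

Lemma bformZ a phi psi : bform (a *: phi) psi = a * bform phi psi.
Proof.
have := @bform_linear psi a phi 0; rewrite addr0 => ->.
by rewrite [X in _ + X]big1 ?addr0 // => z _; rewrite ffunE mul0r mulr0.
Qed.

Lemma bform_gt0 phi : phi != 0 -> 0 < bform phi phi.
Proof.
move=> phi0; have t_ge0 (z : bT) : 0 <= m (val z) * (phi z * phi z).
  by rewrite -expr2 mulr_ge0 ?vmeas_ge0 ?sqr_ge0.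
rewrite lt0r sumr_ge0 // andbT; apply: contra phi0 => /eqP/psumr_eq0P p0.
apply/eqP/ffunP => z; have /eqP := p0 (fun z _ => t_ge0 z) z isT.
rewrite mulf_eq0 (gt_eqF (vmeas_bdry_gt0 (valP z))) /= mulf_eq0 orbb => /eqP->.
by rewrite ffunE.
Qed.

Lemma DtN_adjoint phi psi : bform (DtN phi) psi = bform phi (DtN psi).
Proof. by rewrite bform_DtN tlap_sym -bform_DtN bform_sym. Qed.

Lemma DtN_ge0 phi : 0 <= bform (DtN phi) phi.
Proof. by rewrite bform_DtN energy_ge0. Qed.

Definition bconst : {ffun bT -> R^o} := [ffun=> 1].

Lemma bconst_neq0 : bconst != 0.
Proof.
have [z zb] := set0Pn _ bdry_neq0.
by apply/eqP => /ffunP/(_ (exist _ z zb))/eqP; rewrite !ffunE oner_eq0.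
Qed.

(** The extension has energy 0, so connectedness makes it constant. *)
Lemma DtN_eq0 phi : DtN phi = 0 -> exists a, phi = a *: bconst.
Proof.
move=> D0; have [h b o] := hext_spec phi; have [z0 z0b] := set0Pn _ bdry_neq0.
have E0 : \sum_x hext phi x * tlap (hext phi) x = 0.
  by rewrite -bform_DtN D0 /bform big1 // => z _; rewrite ffunE mul0r mulr0.
exists (hext phi z0); apply/ffunP => z.
rewrite !ffunE -b (energy_eq0_const E0 _ (vbdry_vclos z0b))
  ?(vbdry_vclos (valP z)) //.
exact/esym/mulr1.
Qed.

Lemma DtN_const : DtN bconst = 0.
Proof.
apply/ffunP => z; apply: (mulfI (lt0r_neq0 (vmeas_bdry_gt0 (valP z)))).
rewrite DtN_E ffunE mulr0.
have one x : x \in vc -> 1 = hext bconst x.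
  apply: (@hext_unique _ (fun=> 1)) => [y _|y]; last by rewrite ffunE.
  by rewrite /tlap big1 // => i _; rewrite subrr mulr0.
apply: big1 => y _; have [wzy|/tweight_ngt0->] := boolP (0 < w (val z) y);
  last by rewrite mul0r.
rewrite -!one ?subrr ?mulr0 ?(vbdry_vclos (valP z)) //.
by apply: (@tweight_gt0_vclos _ (val z)); rewrite tweight_sym.
Qed.

(** * The spectrum and its first positive entry *)

Local Notation DtNf := (linfun (@DtN R V mu Omega)).

Lemma linfun_DtN (phi : {ffun bT -> R^o}) : DtNf phi = DtN phi.
Proof.
pose DL := GRing.isLinear.Build _ _ _ _ (@DtN R V mu Omega) DtN_linear.
pose Dl : {linear {ffun bT -> R^o} -> {ffun bT ->
  R^o}} := HB.pack (@DtN R V mu Omega) DL.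
exact: (lfunE Dl).
Qed.

(** Thus 0 is a simple eigenvalue, which prevents entry 1 of the sorted spectrum from being 0. *)
Lemma leigenspace_DtN0 : passmx.leigenspace DtNf 0 = <[bconst]>%VS.
Proof.
apply/vspaceP => phi; rewrite mem_leigenspace linfun_DtN scale0r.
apply/eqP/vlineP => [/DtN_eq0[a ->]|[a ->]]; first by exists a.
by rewrite -linfun_DtN linearZ /= linfun_DtN DtN_const scaler0.
Qed.

Lemma DtN_eigenvalue_ge0 a (phi : {ffun bT -> R^o}) : phi != 0 ->
  DtN phi = a *: phi -> 0 <= a.
Proof.
move=> phi0 Dphi; have := DtN_ge0 phi.
by rewrite Dphi bformZ pmulr_lge0 // bform_gt0.
Qed.

Hypothesis bdry_ge2 : (2 <= #|vb|)%N.

(** The indicator of one of two boundary vertices is not constant, so it lies outside the kernel. *)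
Lemma DtN_neq0 : DtNf != 0.
Proof.
have /card_gt1P[z0 [z1 [z0b z1b z01]]] := bdry_ge2.
apply/eqP => D0.
pose phi : {ffun bT -> R^o} := [ffun z => if val z == z0 then 1 else 0].
have [|a /ffunP phiE] := @DtN_eq0 phi; first by rewrite -linfun_DtN D0 lfunE.
have /= := phiE (exist _ z1 z1b);
  rewrite !ffunE /= eq_sym (negPf z01) => /esym a0.
have /= := phiE (exist _ z0 z0b); rewrite !ffunE /= eqxx a0 => /eqP.
by rewrite oner_eq0.
Qed.

Lemma lambda1_eigenfunction : exists phi : {ffun bT -> R^o},
  [/\ phi != 0, 0 < lambda mu Omega 1 & DtN phi = lambda mu Omega 1 *: phi].
Proof.
have : is_spectrum mu Omega (spectrum mu Omega).
  by apply: classical_sets.xgetPex; exact: eigenvalue_seq.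
rewrite /lambda; move: (spectrum _ _) => s [s_sorted s_count].
have eig a : a \in s -> exists2 phi : {ffun bT ->
  R^o}, phi != 0 & DtN phi = a *: phi.
  rewrite -has_pred1 has_count s_count lt0n dimv_eq0 => v0.
  exists (vpick (passmx.leigenspace DtNf a)); first by rewrite vpick0.
  by apply/eqP; rewrite -linfun_DtN -mem_leigenspace memv_pick.
have in_s a (phi : {ffun bT -> R^o}) : phi != 0 -> DtN phi = a *: phi ->
  a \in s.
  move=> phi0 Dphi; rewrite -has_pred1 has_count s_count lt0n dimv_eq0.
  apply: contra phi0 => /eqP a0; rewrite -memv0 -a0 mem_leigenspace linfun_DtN.
  by rewrite Dphi.
have s_ge0 a : a \in s -> 0 <= a by move=> /eig[phi]; exact: DtN_eigenvalue_ge0.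
have count0 : count_mem 0 s = 1%N.
  by rewrite s_count leigenspace_DtN0 dim_vline bconst_neq0.
have s0 : 0 \in s by rewrite -has_pred1 has_count count0.
have [a [phi [a0 phi0]]] : exists a phi, [/\ a != 0, phi != 0 & DtNf phi =
  a *: phi].
  apply: (@selfadjoint_neq0_eigenvalue _ _ _ bform) DtN_neq0.
  - exact: bform_linear.
  - exact: bform_sym.
  - exact: bform_gt0.
  - by move=> x y; rewrite !linfun_DtN DtN_adjoint.
rewrite linfun_DtN => /(in_s _ _ phi0) as_.
(* A list with fewer than two entries would make [nth] return its default 0. It cannot contain both
   0 and the nonzero [a]. *)
case: s s_sorted eig s_ge0 count0 s0 as_ {s_count in_s} => [|x [|y s]] //=.
  move=> _ _ _ _; rewrite !inE => /eqP<-; by rewrite (negPf a0).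
move=> /andP[xy _] eig s_ge0 count0 _ _.
have y_s : y \in [:: x, y & s] by rewrite !inE eqxx orbT.
have [psi psi0 Dpsi] := eig _ y_s; exists psi; split=> //.
(* If the second entry were 0, the first would be squeezed to 0 as well, against multiplicity
   one. *)
rewrite lt0r s_ge0 // andbT; apply/eqP => y0; move: count0 xy.
rewrite y0 eqxx => count0 x_le0.
have x0 : x = 0 by apply/eqP; rewrite eq_le x_le0 s_ge0 // mem_head.
by move: count0; rewrite x0 eqxx.
Qed.

(** * Sign change of the eigenfunction and conclusion *)

Lemma mean0_pos (phi : {ffun bT -> R^o}) : phi != 0 -> bform phi bconst = 0 ->
  exists z, 0 < phi z.
Proof.
move=> phi0 mean0; apply: contrapT => no_pos; case/eqP: phi0.
have phi_le0 z : phi z <= 0 by rewrite leNgt; apply/negP => z0; apply: no_pos;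
  exists z.
have t_ge0 z : 0 <= - (m (val z) * (phi z * bconst z)).
  by rewrite ffunE mulr1 -mulrN mulr_ge0 ?vmeas_ge0 ?oppr_ge0.
have /eqP := mean0; rewrite -oppr_eq0 /bform -sumrN => /eqP/psumr_eq0P p0.
apply/ffunP => z; have /eqP := p0 (fun z _ => t_ge0 z) z isT.
rewrite oppr_eq0 mulf_eq0 (gt_eqF (vmeas_bdry_gt0 (valP z))) /= !ffunE mulr1.
by move/eqP.
Qed.

Lemma cheeger_jammes_lambda1 :
  2^-1 * cheeger mu Omega * jammes_cheeger mu Omega <= lambda mu Omega 1.
Proof.
have [phi [phi0 a_gt0 Dphi]] := lambda1_eigenfunction;
  set a := lambda _ _ _ in a_gt0 Dphi *.
(* Self-adjointness moves the operator onto the constants, which it kills; the positive factor [a]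
   cancels. *)
have mean0 : bform phi bconst = 0.
  apply: (mulfI (lt0r_neq0 a_gt0));
    rewrite mulr0 -bformZ -Dphi DtN_adjoint DtN_const.
  by rewrite /bform big1 // => z _; rewrite [X in _ * (_ * X)]ffunE !mulr0.
have [z1 z1_gt0] := mean0_pos phi0 mean0.
have [z2 z2_lt0] : exists z, 0 < (- phi) z.
  by apply: mean0_pos; rewrite ?oppr_eq0 // -scaleN1r bformZ mean0 mulr0.
have [harm bdry out] := hext_spec phi.
have bdry_eq z : z \in vb -> tlap (hext phi) z = a * (m z * hext phi z).
  move=> zb; pose z' : bT := exist _ z zb.
  by have := DtN_E phi z'; rewrite Dphi ffunE -bdry => <-; rewrite mulrCA.
pose S := [set x | 0 < hext phi x]%SET;
  pose S' := [set x | 0 < - hext phi x]%SET.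
(* The positive and negative sets are disjoint subsets of the closure, so one of them has at most
   half of its measure. *)
have half : meas mu Omega S + meas mu Omega S' <= meas mu Omega vc.
  rewrite /meas big_mkcond [X in _ +
    X]big_mkcond -big_split [leRHS]big_mkcond /=.
  apply: ler_sum => x _; case: (boolP (x \in vc)) => [_|/out x0];
    rewrite !inE oppr_gt0.
    by case: ltgtP; rewrite ?addr0 ?add0r ?vmeas_ge0.
  by rewrite x0 ltxx addr0.
have [S_le|S_gt] := lerP (meas mu Omega S) (2^-1 * meas mu Omega vc).
  apply: (@cheeger_jammes_le (hext phi)) => //.
  by exists (val z1); rewrite ?(valP z1) // bdry.
have tN x : tlap (fun y => - hext phi y) x = - tlap (hext phi) x.
  by rewrite /tlap -sumrN; apply: eq_bigr => y _; ring.
apply: (@cheeger_jammes_le (fun x => - hext phi x)) => [x xO|z zb|x xc||].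
- by rewrite tN harm // oppr0.
- by rewrite tN bdry_eq //; ring.
- by rewrite out // oppr0.
- by exists (val z2); rewrite ?(valP z2) // bdry; move: z2_lt0; rewrite ffunE.
- by rewrite -/S'; lra.
Qed.

End HarmonicExtension.
End Graph.

Theorem theorem1p3 (R : realType) (V : finType) (mu : V -> V -> R)
    (mu_ge0 : forall x y, 0 <= mu x y)
    (mu_sym : forall x y, mu x y = mu y x)
    (Omega : {set V})
    (Omega_neq0 : Omega != set0)
    (connected_tilde : tilde_connected mu Omega)
    (bdry_ge2 : (2 <= #|vbdry mu Omega|)%N) :
  lambda mu Omega 1 >=
    2^-1 * cheeger mu Omega * jammes_cheeger mu Omega.
Proof.
apply: cheeger_jammes_lambda1 => //.
by rewrite -card_gt0; apply: leq_trans bdry_ge2.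
Qed.
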